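(* Let $(x_t)_{t\in\mathbb{Z}}$ be a real-valued stationary time series and fix a weight $\lambda>0$. Assume: (A1) (Existence) $(x_t)$ admits a weak innovations representation, i.e. there exist causal maps $G,H$ (acting on the infinite past) such that $\nu_t=G(x_t,x_{t-1},\dots)$, $\hat x_t=H(\nu_t,\nu_{t-1},\dots)$, the $\nu_t$ are i.i.d. $\mathcal U[0,1]$, and $(\hat x_t)\stackrel{d}{=}(x_t)$ (equality of all finite-dimensional joint distributions); moreover $H$ is continuous. (A2) (Feasibility) There exist parameters $\tilde\theta_m,\tilde\eta_m$ such that the finite-dimensional maps $G_{\tilde\theta_m},H_{\tilde\eta_m}$ converge uniformly to $G,H$ as $m\to\infty$. (A3) (Training) The training sample sizes are infinite, and for every $m,n$ the training algorithm converges almost surely to a global minimizer $(\theta_m^*,\eta_m^* )$ of the loss $L^{(n)}_m$ defined below. Then for every $n\in\mathbb{Z}^+$, the $m$-dimensional WIAE $(G_{\theta_m^*},H_{\eta_m^*})$ trained with $n$-dimensional discriminators converges in distribution of finite block $n$ to $(G,H)$: for all $t$, as $m\to\infty$, $$\boldsymbol\nu^{*(n)}_{t,m}\stackrel{d}{\to}\boldsymbol\nu^{(n)}_t \quad\text{and}\quad \hat{\boldsymbol x}^{*(n)}_{t,m}\stackrel{d}{\to}\boldsymbol x^{(n)}_t,$$ where $\boldsymbol\nu^{(n)}_t=(\nu_t,\dots,\nu_{t-n+1})$ (a vector of $n$ i.i.d. $\mathcal U[0,1]$ variables) and $\boldsymbol x^{(n)}_t=(x_t,\dots,x_{t-n+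1})$.
   Context: Finite-dimensional Weak Innovations AutoEncoder (WIAE): for each input dimension $m$, $G_\theta:\mathbb{R}^m\to\mathbb{R}$ and $H_\eta:\mathbb{R}^m\to\mathbb{R}$ are parameterized (neural-network) functions; they are regarded as functions of the whole past by ignoring all but the $m$ most recent coordinates (this is the sense of uniform convergence in (A2)). Given parameters $(\theta,\eta)$ define $\nu_{t,m}=G_\theta(x_t,\dots,x_{t-m+1})$ and $\hat x_{t,m}=H_\eta(\nu_{t,m},\dots,\nu_{t-m+1,m})$, and the $n$-blocks $\boldsymbol\nu^{(n)}_{t,m}=(\nu_{t,m},\dots,\nu_{t-n+1,m})$, $\hat{\boldsymbol x}^{(n)}_{t,m}=(\hat x_{t,m},\dots,\hat x_{t-n+1,m})$. The training loss with $n$-dimensional discriminators is $$L^{(n)}_m(\theta,\eta)=\max_{\gamma,\omega}\Big(\mathbb{E}[D_\gamma(\boldsymbol u^{(n)})]-\mathbb{E}[D_\gamma(\boldsymbol\nu^{(n)}_{t,m})]+\lambda\big(\mathbb{E}[D_\omega(\boldsymbol x^{(n)}_t)]-\mathbb{E}[D_\omega(\hat{\boldsymbol x}^{(n)}_{t,m})]\big)\Big),$$ where $\boldsymbol u^{(n)}$ is a vector of $n$ i.i.d. $\mathcal U[0,1]$ variables and the discriminators $D_\gamma,D_\omega:\mathbb{R}^n\to\mathbb{R}$ range over 1-Lipschitz functions, so that (by Kantorovich–Rubinstein duality) $L^{(n)}_m$ equals the 1-Wasserstein distance between the laws of $\boldsymbol u^{(n)}$ and $\boldsymbol\nu^{(n)}_{t,m}$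 plus $\lambda$ times the 1-Wasserstein distance between the laws of $\boldsymbol x^{(n)}_t$ and $\hat{\boldsymbol x}^{(n)}_{t,m}$. The starred quantities $\boldsymbol\nu^{*(n)}_{t,m},\hat{\boldsymbol x}^{*(n)}_{t,m}$ are these blocks computed with the optimal parameters $(\theta_m^*,\eta_m^* )$ minimizing $L^{(n)}_m$. *)

(* Defs.v *)
From HB Require Import structures.
From mathcomp Require Import all_boot all_order all_algebra.
From mathcomp Require Import all_classical all_reals all_analysis.
Import Order.TTheory GRing.Theory Num.Theory.
Import numFieldNormedType.Exports.

Set Implicit Arguments.
Unset Strict Implicit.
Unset Printing Implicit Defensive.

Local Open Scope classical_set_scope.
Local Open Scope ring_scope.

Section WIAE.
Variables (d : measure_display) (T : measurableType d) (R : realType).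
Variable (P : probability T R).

Definition borel_rV (k : nat) : set (set 'rV[R]_k) := <<s [set A | open A] >>.

Definition same_law (k : nat) (X Y : T -> 'rV[R]_k) : Prop :=
  forall A, borel_rV A -> P (X @^-1` A) = P (Y @^-1` A).

Definition fdvec (X : int -> T -> R) (k : nat) (idx : 'I_k -> int) : T -> 'rV[R]_k :=
  fun w => \row_(i < k) X (idx i) w.

Definition rv_process (X : int -> T -> R) : Prop :=
  forall t, measurable_fun setT (X t).

Definition stationary (X : int -> T -> R) : Prop :=
  rv_process X /\
  forall (k : nat) (idx : 'I_k -> int) (h : int),
    same_law (fdvec X (fun i => idx i + h)) (fdvec X idx).

Definition same_fdd (X Y : int -> T -> R) : Prop :=
  forall (k : nat) (idx : 'I_k -> int), same_law (fdvec X idx) (fdvec Y idx).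

Definition mutually_independent (I : eqType) (X : I -> T -> R) : Prop :=
  (forall i, measurable_fun setT (X i)) /\
  forall (s : seq I) (B : I -> set R),
    uniq s -> (forall i, measurable (B i)) ->
    P (\bigcap_(i in [set` s]) (X i @^-1` B i)) =
    (\prod_(i <- s) P (X i @^-1` B i))%E.

Definition uniform01 (Y : T -> R) : Prop :=
  forall B : set R, measurable B ->
    P (Y @^-1` B) = (@lebesgue_measure R) (B `&` `[0%R, 1%R]).

Definition iid_uniform (I : eqType) (X : I -> T -> R) : Prop :=
  mutually_independent X /\ forall i, uniform01 (X i).

(** Continuity of a map on R^N (the infinite past) for the product topology. *)
Definition continuous_seq (F : (nat -> R) -> R) : Prop :=
  forall (s : nat -> R) (e : R), 0 < e ->
    exists (K : nat) (del : R), 0 < del /\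
      forall s' : nat -> R, (forall k, (k < K)%N -> `|s k - s' k| < del) ->
        `|F s - F s'| < e.

Definition causal (F : (nat -> R) -> R) (X : int -> T -> R) : int -> T -> R :=
  fun t w => F (fun k : nat => X (t - k%:Z) w).

Definition weak_innovations (x : int -> T -> R) (G H : (nat -> R) -> R) : Prop :=
  let nu := causal G x in
  let xhat := causal H nu in
  iid_uniform nu /\ rv_process xhat /\ same_fdd xhat x /\ continuous_seq H.

Definition trunc (m : nat) (s : nat -> R) : 'rV[R]_m := \row_(i < m) s i.

Definition unif_conv (F : forall m : nat, 'rV[R]_m -> R) (F0 : (nat -> R) -> R) : Prop :=
  forall e : R, 0 < e -> exists M : nat, forall m : nat, (M <= m)%N ->
    forall s : nat -> R, `|F m (trunc m s) - F0 s| <= e.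

Definition nu_m (m : nat) (Gm : 'rV[R]_m -> R) (x : int -> T -> R) : int -> T -> R :=
  fun t w => Gm (\row_(i < m) x (t - i%:Z) w).

Definition xhat_m (m : nat) (Gm Hm : 'rV[R]_m -> R) (x : int -> T -> R) : int -> T -> R :=
  fun t w => Hm (\row_(i < m) nu_m Gm x (t - i%:Z) w).

Definition block (n : nat) (X : int -> T -> R) (t : int) : T -> 'rV[R]_n :=
  fun w => \row_(i < n) X (t - i%:Z) w.

Definition eucl (n : nat) (v : 'rV[R]_n) : R := Num.sqrt (\sum_(i < n) v ord0 i ^+ 2).

Definition lip1 (n : nat) (D : 'rV[R]_n -> R) : Prop :=
  forall a b, `|D a - D b| <= eucl (a - b).

Definition expect (n : nat) (D : 'rV[R]_n -> R) (X : T -> 'rV[R]_n) : \bar R :=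
  (\int[P]_w (D (X w))%:E)%E.

(** The training loss L^{(n)}_m(theta, eta) with n-dimensional 1-Lipschitz
    discriminators; [u] is a vector of n i.i.d. U[0,1] variables. *)
Definition loss (lam : R) (n m : nat) (u : T -> 'rV[R]_n) (x : int -> T -> R)
    (Gm Hm : 'rV[R]_m -> R) : \bar R :=
  ereal_sup [set (expect Dg u - expect Dg (block n (nu_m Gm x) 0)
                  + lam%:E * (expect Dw (block n x 0)
                              - expect Dw (block n (xhat_m Gm Hm x) 0)))%E
            | Dg in [set D | lip1 D] & Dw in [set D | lip1 D]].

Definition conv_dist (n : nat) (Xm : nat -> T -> 'rV[R]_n) (X : T -> 'rV[R]_n) : Prop :=
  forall f : 'rV[R]_n -> R, continuous f -> (exists C : R, forall v, `|f v| <= C) ->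
    (fun m => expect f (Xm m)) @ \oo --> expect f X.

Definition borel_fun (k : nat) (F : 'rV[R]_k -> R) : Prop :=
  forall A : set R, measurable A -> borel_rV (F @^-1` A).

Definition uvec (n : nat) (U : nat -> T -> R) : T -> 'rV[R]_n :=
  fun w => \row_(i < n) U i w.

End WIAE.

(* Main.v *)
Require Import Defs.
From HB Require Import structures.
From mathcomp Require Import all_boot all_order all_algebra.
From mathcomp Require Import all_classical all_reals all_analysis.
From mathcomp Require Import measurable_realfun ring lra.
Import Order.TTheory GRing.Theory Num.Theory.
Import numFieldNormedType.Exports.
Local Open Scope classical_set_scope.
Local Open Scope ring_scope.

(** Almost surely the innovations path lies in the compact cube [0,1]^N, on which the
    continuous map [H] is bounded and around which it is uniformly continuous. Hence the
    feasible networks of (A2) produce blocks uniformly close to the ideal ones, and since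
    [x] and [H(nu)] have the same law, as do [u] and the blocks of [nu], the loss of the
    feasible networks tends to 0. By optimality so does the loss of the trained networks.
    That loss dominates the discrepancy on every bounded 1-Lipschitz test function, and such
    functions determine weak convergence by inf-convolution. Stationarity moves the
    conclusion from time 0 to time [t]. *)

(** * Borel sets of row vectors, generated by boxes *)

(** Row vectors as a measurable type whose measurable sets are exactly [borel_rV], so that laws of
    random vectors can be handled as pushforward measures. *)
Definition rV_borel (R : realType) (k : nat) :=
  g_sigma_algebraType [set A : set 'rV[R]_k | open A].

Definition rV_box {R : realType} {k : nat} (B : 'I_k -> set R) : set 'rV[R]_k :=
  [set v | forall i, B i (v ord0 i)].

Definition rV_boxes (R : realType) (k : nat) : set (set 'rV[R]_k) :=
  [set A | exists2 B : 'I_k -> set R, (forall i, measurable (B i)) & A = rV_box B].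

(** Balls of the sup norm are cubes, and the cubes with rational centre and radius form a base. The
    index type [{ffun 'I_k -> rat} * rat] is countable, so the union stays inside the sigma-algebra
    generated by boxes. *)
Lemma open_rV_bigcup_box (R : realType) (k : nat) (A : set 'rV[R]_k) : open A ->
  exists (D : set ({ffun 'I_k -> rat} * rat)),
    A = \bigcup_(a in D) rV_box (fun i => ball (ratr (a.1 i) : R) (ratr a.2)).
Proof.
move=> oA; exists [set a : {ffun 'I_k -> rat} * rat | rV_box (fun i => ball (ratr (a.1 i) : R) (ratr a.2)) `<=` A].
apply/seteqP; split=> [v Av|v [a aA av]]; last exact: aA.
have /nbhs_ballP[e /= e0 veA] : nbhs v A by exact: open_nbhs_nbhs.
have [r] : exists r : rat, ratr r \in `]0, (e / 2)[.
  by apply: rat_in_itvoo; lra.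
rewrite in_itv/= => /andP[r0 re].
have /choice[c cP] : forall i, exists c : rat, ball (ratr c : R) (ratr r) (v ord0 i).
  move=> i; have [c] : exists c : rat, ratr c \in `](v ord0 i - ratr r), (v ord0 i + ratr r)[.
    by apply: rat_in_itvoo; lra.
  by rewrite in_itv/= => cP; exists c; rewrite /ball/= ltr_norml; lra.
exists ([ffun i => c i], r) => /= [u uB|i]; last by rewrite ffunE; exact: cP.
apply: veA; split=> // i j; rewrite ord1.
have := uB j; have := cP j; rewrite /= ffunE /ball/= !ltr_norml; lra.
Qed.

Lemma rV_coord_continuous (R : realType) (k : nat) (i : 'I_k) :
  continuous (fun v : 'rV[R]_k => v ord0 i).
Proof. by move=> v; exact: coord_continuous. Qed.

Lemma continuous_rV_measurable (R : realType) (k : nat) (f : 'rV[R]_k -> R) :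
  continuous f -> measurable_fun setT (f : rV_borel R k -> R).
Proof.
move=> /continuousP cf; apply: (measurability _ (RGenOpens.measurableE R)).
move=> _ [_ [a [b ->] <-]]; rewrite setTI.
apply: sub_sigma_algebra; apply: cf; exact: interval_open.
Qed.

Lemma rV_box_preimage {R : realType} {U : Type} {k : nat} (X : U -> 'rV[R]_k)
    (B : 'I_k -> set R) :
  X @^-1` rV_box B = \bigcap_i ((fun w => X w ord0 i) @^-1` B i).
Proof. by apply/seteqP; split=> w /= h i => [_|]; apply: h. Qed.

Lemma measurable_rV_box (d : measure_display) (U : measurableType d) (R : realType)
    (k : nat) (X : U -> 'rV[R]_k) (B : 'I_k -> set R) :
  (forall i, measurable_fun setT (fun w => X w ord0 i)) ->
  (forall i, measurable (B i)) -> measurable (X @^-1` rV_box B).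
Proof.
move=> mX mB; rewrite rV_box_preimage; apply: fin_bigcap_measurable => // i _.
by rewrite -[X in measurable X]setTI; apply: mX.
Qed.

Lemma borel_rVE (R : realType) (k : nat) :
  @borel_rV R k = <<s @rV_boxes R k >>.
Proof.
apply/seteqP; split; apply: smallest_sub; try exact: smallest_sigma_algebra.
- move=> A /open_rV_bigcup_box[D ->]; rewrite bigcup_mkcond.
  apply: (@countable_bigcupT_measurable _ (g_sigma_algebraType (@rV_boxes R k))) => //.
  move=> a; case: ifP => _; last exact: measurable0.
  apply: sub_sigma_algebra; eexists; last reflexivity.
  by move=> i; rewrite /= ball_itv; exact: measurable_itv.
- move=> _ [B mB ->]; apply: (@measurable_rV_box _ (rV_borel R k) _ _ id B) => // i.
  exact: (@continuous_rV_measurable _ _ _ (@rV_coord_continuous _ _ i)).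
Qed.

Lemma measurable_rV (d : measure_display) (U : measurableType d) (R : realType)
    (k : nat) (X : U -> 'rV[R]_k) :
  (forall i, measurable_fun setT (fun w => X w ord0 i)) ->
  measurable_fun setT (X : U -> rV_borel R k).
Proof.
move=> mX; apply: (@measurability _ _ U (rV_borel R k) setT X (@rV_boxes R k) (borel_rVE R k)).
by move=> _ [_ [B mB ->] <-]; rewrite setTI; exact: measurable_rV_box.
Qed.

Lemma measurable_rV_coord (R : realType) (k : nat) (i : 'I_k) :
  measurable_fun setT (fun v : rV_borel R k => v ord0 i).
Proof. exact: (@continuous_rV_measurable _ _ _ (@rV_coord_continuous _ _ i)). Qed.

Lemma borel_fun_measurable (R : realType) (k : nat) (F : 'rV[R]_k -> R) :
  borel_fun F -> measurable_fun setT (F : rV_borel R k -> R).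
Proof. by move=> bF _ A mA; rewrite setTI; exact: bF. Qed.

Lemma rV_borel_preimage (d : measure_display) (U : measurableType d) (R : realType)
    (k : nat) (X : U -> 'rV[R]_k) (A : set 'rV[R]_k) :
  measurable_fun setT (X : U -> rV_borel R k) -> borel_rV A ->
  measurable (X @^-1` A).
Proof. by move=> mX bA; rewrite -[X in measurable X]setTI; apply: mX. Qed.

(** * Equality in law, expectations and i.i.d. uniform vectors *)

(** Uniqueness of measures on a pi-system: boxes are stable under intersection, generate the Borel
    sets and include the whole space, which has finite mass. *)
Lemma same_law_box (d : measure_display) (T : measurableType d) (R : realType)
    (P : probability T R) (k : nat) (X Y : T -> 'rV[R]_k) :
  measurable_fun setT (X : T -> rV_borel R k) ->
  measurable_fun setT (Y : T -> rV_borel R k) ->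
  (forall B : 'I_k -> set R, (forall i, measurable (B i)) ->
     P (X @^-1` rV_box B) = P (Y @^-1` rV_box B)) ->
  same_law P X Y.
Proof.
move=> mX mY XY A bA.
pose X' : {mfun T >-> rV_borel R k} := HB.pack X (isMeasurableFun.Build _ _ _ _ _ mX).
pose Y' : {mfun T >-> rV_borel R k} := HB.pack Y (isMeasurableFun.Build _ _ _ _ _ mY).
apply: (@measure_unique _ R (rV_borel R k) (@rV_boxes R k) (fun=> setT) _ _ _ _
  (pushforward P X') (pushforward P Y')) => //.
- exact: borel_rVE.
- move=> _ _ [B mB ->] [C mC ->]; exists (fun i => B i `&` C i).
    by move=> i; exact: measurableI.
  apply/seteqP; split=> v /=; first by move=> [vB vC] i; split; [exact: vB|exact: vC].
  by move=> vBC; split=> i; have [] := vBC i.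
- move=> _; exists (fun=> setT) => //.
  by apply/seteqP; split.
- by rewrite bigcup_const.
- by move=> _ [B mB ->]; exact: XY.
- by move=> _; change (P setT < +oo)%E; rewrite probability_setT ltry.
Qed.

Lemma same_law_expect (d : measure_display) (T : measurableType d) (R : realType)
    (P : probability T R) (k : nat) (X Y : T -> 'rV[R]_k) (f : 'rV[R]_k -> R) :
  measurable_fun setT (X : T -> rV_borel R k) ->
  measurable_fun setT (Y : T -> rV_borel R k) ->
  measurable_fun setT (f : rV_borel R k -> R) ->
  same_law P X Y -> expect P f X = expect P f Y.
Proof.
move=> mX mY mf XY; rewrite /expect.
(* Change of variables needs no integrability for nonnegative functions. Applied to the positive and
   negative parts of [f], it gives equality of the expectations even when they are infinite. *)
have key (g : rV_borel R k -> \bar R) : measurable_fun setT g -> (forall v, 0 <= g v)%E ->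
    (\int[P]_w g (X w) = \int[P]_w g (Y w))%E.
  move=> mg g0.
  have := @ge0_integral_pushforward _ _ _ _ R _ mX P setT g measurableT mg (fun v _ => g0 v).
  have := @ge0_integral_pushforward _ _ _ _ R _ mY P setT g measurableT mg (fun v _ => g0 v).
  rewrite !preimage_setT => <- <-.
  pose X' : {mfun T >-> rV_borel R k} := HB.pack X (isMeasurableFun.Build _ _ _ _ _ mX).
  pose Y' : {mfun T >-> rV_borel R k} := HB.pack Y (isMeasurableFun.Build _ _ _ _ _ mY).
  apply: (@eq_measure_integral _ _ _ _ (pushforward P Y') (pushforward P X')).
  by move=> A mA _; exact: XY.
have mEf : measurable_fun setT (EFin \o f : rV_borel R k -> \bar R) by exact/measurable_EFinP.
rewrite integralE [in RHS]integralE; congr (_ - _)%E.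
- have := key _ (measurable_funepos mEf) (funepos_ge0 _).
  by congr eq; apply: eq_integral => w _; rewrite !funeposE.
- have := key _ (measurable_funeneg mEf) (funeneg_ge0 _).
  by congr eq; apply: eq_integral => w _; rewrite !funenegE.
Qed.

Lemma iid_uniform_box (d : measure_display) (T : measurableType d) (R : realType)
    (P : probability T R) (I : eqType) (X : I -> T -> R) (k : nat) (idx : 'I_k -> I)
    (B : 'I_k -> set R) :
  iid_uniform P X -> injective idx -> (forall i, measurable (B i)) ->
  P ((fun w => \row_i X (idx i) w) @^-1` rV_box B) =
  (\prod_(i < k) (@lebesgue_measure R) (B i `&` `[0%R, 1%R]))%E.
Proof.
move=> [[mX indX] uX] inj_idx mB.
(* The sides are carried from ['I_k] to the index set of the process, with the whole line off the
   range of [idx]. Injectivity of [idx] ensures that the index picked is the original one. *)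
pose C (j : I) : set R := if [pick i | idx i == j] is Some i then B i else setT.
have CE i : C (idx i) = B i.
  rewrite /C; case: pickP => [i' /eqP/inj_idx -> //|/(_ i)].
  by rewrite eqxx.
have mC j : measurable (C j) by rewrite /C; case: pickP.
have := indX [seq idx i | i <- enum 'I_k] C.
rewrite map_inj_uniq ?enum_uniq// => /(_ isT mC).
rewrite big_map big_enum/= => PE.
rewrite (_ : _ @^-1` _ =
    \bigcap_(i in [set` [seq idx i | i <- enum 'I_k]]) (X i @^-1` C i)).
  rewrite PE; apply: eq_bigr => i _; rewrite CE; exact: uX.
apply/seteqP; split=> w /= h.
  move=> _ /mapP[i _ ->]; rewrite CE; have := h i; by rewrite mxE.
move=> i; rewrite mxE -CE; apply: h => /=.
by apply: map_f; rewrite mem_enum.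
Qed.

Lemma iid_uniform_same_law (d : measure_display) (T : measurableType d) (R : realType)
    (P : probability T R) (I J : eqType) (X : I -> T -> R) (Y : J -> T -> R)
    (k : nat) (idx : 'I_k -> I) (jdx : 'I_k -> J) :
  iid_uniform P X -> iid_uniform P Y -> injective idx -> injective jdx ->
  same_law P (fun w => \row_i X (idx i) w) (fun w => \row_i Y (jdx i) w).
Proof.
move=> uX uY iidx ijdx; apply: same_law_box.
- apply: measurable_rV => i; under eq_fun do rewrite mxE.
  by case: uX => -[mX _] _; exact: mX.
- apply: measurable_rV => i; under eq_fun do rewrite mxE.
  by case: uY => -[mY _] _; exact: mY.
- by move=> B mB; rewrite !iid_uniform_box.
Qed.

Lemma same_law_comp (d : measure_display) (T : measurableType d) (R : realType)
    (P : probability T R) (k l : nat) (X Y : T -> 'rV[R]_k) (F : 'rV[R]_k -> 'rV[R]_l) :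
  measurable_fun setT (F : rV_borel R k -> rV_borel R l) ->
  same_law P X Y -> same_law P (F \o X) (F \o Y).
Proof.
move=> mF XY A bA.
exact: (XY (F @^-1` A) (@rV_borel_preimage _ (rV_borel R k) _ _ F A mF bA)).
Qed.

(** * Almost sure bounds and integrals *)

Lemma uniform01_ae (d : measure_display) (T : measurableType d) (R : realType)
    (P : probability T R) (Y : T -> R) : measurable_fun setT Y ->
  uniform01 P Y -> \forall w \ae P, 0 <= Y w <= 1.
Proof.
move=> mY uY; exists (Y @^-1` (~` `[0, 1])); split.
- rewrite -[X in measurable X]setTI; apply: mY => //; exact: measurableC.
- by rewrite uY ?setICl ?measure0//; exact: measurableC.
- by move=> w /= h; rewrite in_itv/=.
Qed.

Lemma ae_bounded_integrable (d : measure_display) (T : measurableType d) (R : realType)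
    (P : probability T R) (f : T -> R) (C : R) : measurable_fun setT f ->
  (\forall w \ae P, `|f w| <= C) -> P.-integrable setT (EFin \o f).
Proof.
move=> mf fC; apply/integrableP; split; first exact/measurable_EFinP.
apply: (@le_lt_trans _ _ (\int[P]_w (`|C|%:E))%E).
  apply: ae_ge0_le_integral => //=.
  - exact/measurable_EFinP/measurableT_comp.
  - by apply: filterS fC => w fw _; rewrite lee_fin (le_trans fw)// ler_norm.
by rewrite integral_cst//= probability_setT mule1 ltry.
Qed.

Lemma le_expect_bounded (d : measure_display) (T : measurableType d) (R : realType)
    (P : probability T R) (f g : T -> R) (c : R) : 0 <= c ->
  P.-integrable setT (EFin \o f) -> P.-integrable setT (EFin \o g) ->
  (\forall w \ae P, `|f w - g w| <= c) ->
  (\int[P]_w (f w)%:E <= \int[P]_w (g w)%:E + c%:E)%E.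
Proof.
move=> c0 intf intg fgc.
have fing : (\int[P]_w (g w)%:E)%E \is a fin_num by exact: integrable_fin_num intg.
rewrite addeC -leeBlDr// -(integralB measurableT intf intg)/=.
apply: (le_trans (lee_abs _)).
apply: (@le_trans _ _ (\int[P]_w (c%:E))%E); last first.
  by rewrite integral_cst//= probability_setT mule1.
have mfg : measurable_fun setT (fun w => (f w)%:E - (g w)%:E)%E.
  exact: (measurable_int _ (integrableB measurableT intf intg)).
apply: (le_trans (le_abse_integral _ measurableT mfg)).
apply: ae_ge0_le_integral => //.
- exact: (measurableT_comp (@abse_measurable _ _) mfg).
- by apply: filterS fgc => w fgw _; rewrite -EFinB lee_fin.
Qed.

(** * Norms, Lipschitz functions, inf-convolution and weak convergence *)

Lemma rV_norm_le (R : realType) (n : nat) (v : 'rV[R]_n) (c : R) : 0 <= c ->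
  (forall i, `|v ord0 i| <= c) -> `|v| <= c.
Proof.
move=> c0 vc; rewrite [leLHS]/Num.Def.normr/= mx_normrE; apply/bigmax_leP; split => // -[i j] _.
by rewrite ord1; exact: vc.
Qed.

Lemma rV_coord_le_norm (R : realType) (n : nat) (v : 'rV[R]_n) (i : 'I_n) :
  `|v ord0 i| <= `|v|.
Proof.
by rewrite [leRHS]/Num.Def.normr/= mx_normrE; apply/bigmax_geP; right; exists (ord0, i).
Qed.

Lemma rV_norm_le_eucl (R : realType) (n : nat) (v : 'rV[R]_n) : `|v| <= eucl v.
Proof.
apply: rV_norm_le => [|i]; first exact: sqrtr_ge0.
rewrite -sqrtr_sqr; apply: ler_wsqrtr; rewrite (bigD1 i)//= lerDl.
by apply: sumr_ge0 => j _; exact: sqr_ge0.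
Qed.

(** The sharp constant is the square root of [n]; the cruder [n] avoids roots and is enough wherever
    only smallness of [c] for fixed [n] matters. *)
Lemma eucl_le (R : realType) (n : nat) (v : 'rV[R]_n) (c : R) : 0 <= c ->
  (forall i, `|v ord0 i| <= c) -> eucl v <= n%:R * c.
Proof.
move=> c0 vc; rewrite -(ger0_norm (_ : 0 <= n%:R * c)) ?mulr_ge0//.
rewrite -sqrtr_sqr; apply: ler_wsqrtr.
apply: (@le_trans _ _ (\sum_(i < n) c ^+ 2)).
  by apply: ler_sum => i _; rewrite -real_normK ?num_real// lerXn2r// ?nnegrE.
rewrite sumr_const card_ord -[leLHS]mulr_natl exprMn ler_wpM2r ?sqr_ge0//.
by rewrite -natrX ler_nat; case: n {v vc} => // n; rewrite leq_pmulr.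
Qed.

Lemma lip1_continuous (R : realType) (n : nat) (D : 'rV[R]_n -> R) :
  lip1 D -> continuous D.
Proof.
move=> lD v; apply/(@cvgrPdist_le _ _ _ (nbhs v) (nbhs_filter v)) => e e0.
near=> u.
apply: (le_trans (lD _ _)).
have n0 : 0 < n%:R + 1 :> R by rewrite ltr_wpDl.
(* The denominator [n%:R + 1] rather than [n%:R] covers [n = 0]. *)
apply: (@le_trans _ _ (n%:R * (e / (n%:R + 1)))).
  apply: eucl_le => [|i]; first by rewrite divr_ge0 ?ltW.
  apply: (le_trans (rV_coord_le_norm _ _ _ _)); near: u.
  by apply: cvgr_dist_le; [exact: cvg_id|rewrite divr_gt0].
by rewrite mulrA ler_pdivrMr// mulrC ler_wpM2l ?(ltW e0)// lerDl.
Unshelve. all: by end_near. Qed.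

(* The sup norm of 'rV[R]_n replaces the Euclidean one here: being smaller, it still yields
   Lipschitz functions in the sense of [lip1], without Minkowski's inequality. *)
Definition infconv {R : realType} {n : nat} (f : 'rV[R]_n -> R) (k : R) (v : 'rV[R]_n) : R :=
  inf [set f y + k * `|v - y| | y in [set: 'rV[R]_n]].

Lemma infconv_lb (R : realType) (n : nat) (f : 'rV[R]_n -> R) (k C : R) v : 0 <= k ->
  (forall v, `|f v| <= C) -> lbound [set f y + k * `|v - y| | y in [set: 'rV[R]_n]] (- C).
Proof.
move=> k0 fC _ [y _ <-]; have := fC y; rewrite ler_norml => /andP[fy _].
by rewrite (le_trans fy)// lerDl mulr_ge0.
Qed.

Lemma infconv_le (R : realType) (n : nat) (f : 'rV[R]_n -> R) (k C : R) v y : 0 <= k ->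
  (forall v, `|f v| <= C) -> infconv f k v <= f y + k * `|v - y|.
Proof.
move=> k0 fC; apply: ge_inf; last by exists y.
by exists (- C); exact: infconv_lb.
Qed.

Lemma infconv_ge (R : realType) (n : nat) (f : 'rV[R]_n -> R) (k c : R) v :
  (forall y, c <= f y + k * `|v - y|) -> c <= infconv f k v.
Proof.
move=> cf; apply: lb_le_inf; last by move=> _ [y _ <-].
by exists (f v + k * `|v - v|); exists v.
Qed.

Lemma infconv_le_fun (R : realType) (n : nat) (f : 'rV[R]_n -> R) (k C : R) v : 0 <= k ->
  (forall v, `|f v| <= C) -> infconv f k v <= f v.
Proof.
by move=> k0 fC; have := infconv_le _ _ f _ _ v v k0 fC; rewrite subrr normr0 mulr0 addr0.
Qed.

Lemma infconv_bounded (R : realType) (n : nat) (f : 'rV[R]_n -> R) (k C : R) v : 0 <= k ->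
  (forall v, `|f v| <= C) -> `|infconv f k v| <= C.
Proof.
move=> k0 fC; rewrite ler_norml; apply/andP; split.
  by apply: infconv_ge => y; apply: (infconv_lb _ _ f _ _ v k0 fC); exists y.
apply: (le_trans (infconv_le_fun _ _ _ _ _ _ k0 fC)).
by have := fC v; rewrite ler_norml => /andP[].
Qed.

Lemma infconv_lip (R : realType) (n : nat) (f : 'rV[R]_n -> R) (k C : R) u v : 0 <= k ->
  (forall v, `|f v| <= C) -> infconv f k u - infconv f k v <= k * `|u - v|.
Proof.
move=> k0 fC; rewrite lerBlDr -lerBlDl; apply: infconv_ge => y.
rewrite lerBlDl addrCA; apply: (le_trans (infconv_le _ _ _ _ _ _ y k0 fC)).
rewrite lerD2l -mulrDr ler_wpM2l//.
by rewrite -(subrKA v); exact: ler_normD.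
Qed.

Lemma infconv_lip1 (R : realType) (n : nat) (f : 'rV[R]_n -> R) (k C : R) : 0 < k ->
  (forall v, `|f v| <= C) -> lip1 (fun v => k^-1 * infconv f k v).
Proof.
move=> k0 fC a b; rewrite -mulrBr normrM gtr0_norm ?invr_gt0// ler_pdivrMl//.
apply: (@le_trans _ _ (k * `|a - b|)); last first.
  by rewrite ler_wpM2l ?(ltW k0)// rV_norm_le_eucl.
rewrite ler_norml lerNl opprB.
by rewrite {1}distrC !(@infconv_lip _ _ _ _ C)// ltW.
Qed.

(** Points [y] near [v] cannot lower the infimum by more than [e], by continuity; for large [k] the
    penalty rules out all the others. *)
Lemma infconv_cvg (R : realType) (n : nat) (f : 'rV[R]_n -> R) (C : R) (v : 'rV[R]_n) :
  continuous f -> (forall v, `|f v| <= C) ->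
  infconv f k.+1%:R v @[k --> \oo] --> f v.
Proof.
move=> cf fC; apply/cvgrPdist_le => e e0.
have /nbhs_ballP[/= r r0 rP] : \forall y \near v, `|f v - f y| <= e.
  by have /cvgrPdist_le := cf v; exact.
near=> k.
rewrite ger0_norm ?subr_ge0 ?(@infconv_le_fun _ _ _ _ C)//.
rewrite lerBlDr -lerBlDl; apply: infconv_ge => y.
have C0 : 0 <= C by exact: le_trans (fC v).
have [vyr|ryv] := ltP `|v - y| r.
  have := rP y; rewrite -ball_normE/= => /(_ vyr); rewrite ler_norml => /andP[_].
  have : 0 <= k.+1%:R * `|v - y| by rewrite mulr_ge0.
  lra.
(* Off the ball of radius [r] the penalty exceeds the largest possible oscillation [C + C] of
   [f]. *)
have : C + C <= k.+1%:R * `|v - y|.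
  apply: (@le_trans _ _ (k.+1%:R * r)); last by rewrite ler_wpM2l.
  rewrite -ler_pdivrMr//; near: k.
  by apply: filterS (nbhs_infty_ger ((C + C) / r)) => k /le_trans; apply; rewrite ler_nat.
have := fC v; have := fC y; rewrite !ler_norml => /andP[? ?] /andP[? ?]; lra.
Unshelve. all: by end_near. Qed.

(* Only one inequality is required since [- D] is again a bounded Lipschitz test function;
   [infconv f k] increases to [f] and is [k]-Lipschitz, which reduces continuous test
   functions to Lipschitz ones. *)
Lemma conv_dist_lip (d : measure_display) (T : measurableType d) (R : realType)
    (P : probability T R) (n : nat) (Xm : nat -> T -> 'rV[R]_n) (X : T -> 'rV[R]_n) :
  (forall m, measurable_fun setT (Xm m : T -> rV_borel R n)) ->
  measurable_fun setT (X : T -> rV_borel R n) ->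
  (forall (D : 'rV[R]_n -> R) (C : R), lip1 D -> (forall v, `|D v| <= C) ->
     forall e : R, 0 < e ->
     \forall m \near \oo, (expect P D X <= expect P D (Xm m) + e%:E)%E) ->
  conv_dist P Xm X.
Proof.
move=> mXm mX HD f cf [C fC].
have mcomp (g : 'rV[R]_n -> R) (Y : T -> 'rV[R]_n) : continuous g ->
    measurable_fun setT (Y : T -> rV_borel R n) -> measurable_fun setT (g \o Y).
  move=> cg mY.
  exact: (measurableT_comp (continuous_rV_measurable _ _ _ cg) mY).
have intg (g : 'rV[R]_n -> R) (c : R) (Y : T -> 'rV[R]_n) : continuous g ->
    (forall v, `|g v| <= c) -> measurable_fun setT (Y : T -> rV_borel R n) ->
    P.-integrable setT (EFin \o (g \o Y)).
  move=> cg gc mY; apply: (@ae_bounded_integrable _ _ _ _ _ c); first exact: mcomp.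
  by apply: nearW => w; exact: gc.
have lsc (g : 'rV[R]_n -> R) : continuous g -> (forall v, `|g v| <= C) ->
    forall e : R, 0 < e ->
    \forall m \near \oo, (expect P g X <= expect P g (Xm m) + e%:E)%E.
  move=> cg gC e e0.
  pose gk (k : nat) := infconv g k.+1%:R.
  have gk_bnd k v : `|gk k v| <= C by exact: infconv_bounded.
  have k0 k : 0 < k.+1%:R :> R by rewrite ltr0n.
  have gk_cont k : continuous (gk k).
    have -> : gk k = (fun v => k.+1%:R * (k.+1%:R^-1 * gk k v)).
      by apply/funext => v; rewrite mulVKf// lt0r_neq0.
    move=> v; apply: (@cvgM _ _ (nbhs v) (nbhs_filter v) (fun=> k.+1%:R)).
      exact: (@cvg_cst _ _ _ (nbhs v) (nbhs_filter v)).
    exact: (lip1_continuous _ _ _ (infconv_lip1 _ _ _ _ _ (k0 k) gC)).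
  have : \forall k \near \oo, (expect P g X <= expect P (gk k) X + (e / 2)%:E)%E.
    have [] := @dominated_convergence _ _ _ P setT measurableT
      (fun k w => (gk k (X w))%:E) (fun w => (g (X w))%:E) (fun=> C%:E).
    - by move=> k; apply/measurable_EFinP; exact: mcomp.
    - by apply/measurable_EFinP; exact: mcomp.
    - apply: nearW => w _; apply: cvg_EFin; first by near=> k.
      exact: infconv_cvg.
    - exact: finite_measure_integrable_cst.
    - by apply: nearW => w k _; rewrite lee_fin.
    have fing : expect P g X \is a fin_num by exact: integrable_fin_num (intg _ _ _ cg gC mX).
    move=> _ _; rewrite -/(expect P g X) -(fineK fing) => /fine_cvgP[_] /cvgrPdist_le.
    move=> /(_ (e / 2)); rewrite divr_gt0// => /(_ isT).
    apply: filterS => k; rewrite /= -/(expect P (gk k) X).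
    have fink : expect P (gk k) X \is a fin_num.
      exact: integrable_fin_num (intg _ _ _ (gk_cont k) (gk_bnd k) mX).
    by rewrite -[in X in _ -> (_ <= X)%E](fineK fink) -EFinD lee_fin ler_norml; lra.
  move=> /(@filter_ex _ \oo)[k gkE].
  pose h v : R := k.+1%:R^-1 * gk k v.
  have gk_int (Y : T -> 'rV[R]_n) : measurable_fun setT (Y : T -> rV_borel R n) ->
      P.-integrable setT (EFin \o (gk k \o Y)) by exact: intg.
  have expectE (Y : T -> 'rV[R]_n) : measurable_fun setT (Y : T -> rV_borel R n) ->
      expect P h Y = ((k.+1%:R^-1)%:E * expect P (gk k) Y)%E.
    by move=> mY; rewrite /expect -(integralZl measurableT (gk_int Y mY)).
  (* The rescaled function [h] is 1-Lipschitz. Asking for the error [k.+1%:R^-1 * (e / 2)] leaves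
     [e / 2] once the scaling is undone; the other half pays for replacing [g] by [gk k] under [X].
     Under [Xm m] the replacement is free, since [gk k] lies below [g]. *)
  have := HD h (k.+1%:R^-1 * C) (infconv_lip1 _ _ _ _ _ (k0 k) gC).
  move=> /(_ _ (k.+1%:R^-1 * (e / 2))) HDk.
  have {}HDk : \forall m \near \oo, (expect P h X <=
      expect P h (Xm m) + (k.+1%:R^-1 * (e / 2))%:E)%E.
    apply: HDk => [v|]; last by rewrite mulr_gt0 ?invr_gt0// divr_gt0.
    by rewrite normrM gtr0_norm ?invr_gt0// ler_wpM2l ?invr_ge0//; exact: gk_bnd.
  apply: filterS HDk => m; rewrite !expectE//.
  rewrite EFinM -muleDr//; last first.
    by rewrite fin_num_adde_defl.
  rewrite lee_pmul2l// ?lte_fin ?invr_gt0// => gkXm.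
  apply: (le_trans gkE); rewrite [e in leRHS]splitr EFinD addeA leeD2r//.
  apply: (le_trans gkXm); rewrite leeD2r//.
  apply: le_integral => //; [exact: gk_int|exact: intg|].
  by move=> w _; rewrite lee_fin; exact: infconv_le_fun.
have finX (Y : T -> 'rV[R]_n) : measurable_fun setT (Y : T -> rV_borel R n) ->
    expect P f Y \is a fin_num.
  by move=> mY; exact: integrable_fin_num (intg _ _ _ cf fC mY).
rewrite -(fineK (finX _ mX)); apply/fine_cvgP; split.
  by apply: nearW => m; exact: finX.
apply/cvgrPdist_le => e e0.
(* The lower bound for [- f] is the upper bound for [f]. *)
have cfN : continuous (fun v => - f v) by move=> v; apply: (@cvgN _ _ _ (nbhs v) (nbhs_filter v)); exact: cf.
have fCN v : `|- f v| <= C by rewrite normrN.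
have := lsc _ cfN fCN _ e0; have := lsc _ cf fC _ e0.
apply: filterS2 => m /=.
have expectN (Y : T -> 'rV[R]_n) : measurable_fun setT (Y : T -> rV_borel R n) ->
    expect P (fun v => - f v) Y = (- expect P f Y)%E.
  by move=> mY; rewrite /expect -(integralN (integrable_add_def measurableT (intg _ _ _ cf fC mY))).
rewrite !expectN// -(fineK (finX _ mX)) -(fineK (finX _ (mXm m))) /=.
by rewrite -?EFinN -?EFinD !lee_fin ler_norml; lra.
Unshelve. all: by end_near. Qed.

(** * Continuous maps on the compact cube of sequences *)

Lemma nbhs_seq_coord (R : realType) (x : {ptws nat -> R}) (K : nat) (e : R) : 0 < e ->
  \forall s \near x, forall k, (k < K)%N -> `|x k - s k| < e.
Proof.
move=> e0; elim: K => [|K IH]; first exact: (@filterE _ (nbhs x) (nbhs_filter x)).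
have HK : \forall s \near x, `|x K - s K| < e.
  have /(@cvgrPdist_lt R R {ptws nat -> R} (nbhs x) (nbhs_filter x)) :=
    @proj_continuous nat (fun=> R) K x.
  exact.
apply: (@filterS2 _ (nbhs x) (nbhs_filter x) _ _ _ _ IH HK) => s {}IH {}HK k; rewrite ltnS leq_eqVlt => /predU1P[->//|].
exact: IH.
Qed.

Lemma unit_cube_compact (R : realType) :
  compact [set s : {ptws nat -> R} | forall k, `[0, 1]%classic (s k)].
Proof.
exact: (@tychonoff nat (fun=> R) (fun=> `[0, 1]%classic) (fun=> @segment_compact R 0 1)).
Qed.

(** A Heine-Cantor argument by compactness of the cube. Only [s] is confined to the cube: [s'] will
    be the output of a network, which may leave it. *)
Lemma continuous_seq_cube_unif (R : realType) (H : (nat -> R) -> R) (e : R) :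
  continuous_seq H -> 0 < e ->
  exists2 del : R, 0 < del & forall s, (forall k, 0 <= s k <= 1) ->
    forall s', (forall k, `|s k - s' k| < del) -> `|H s - H s'| < e.
Proof.
move=> cH e0.
have /compact_near_coveringP/(_ R (0^'+)
  (fun del s => forall s', (forall k, `|s k - s' k| < del) -> `|H s - H s'| < e)
  _) := unit_cube_compact R.
case.
  move=> x _; have [|K [del [del0 HK]]] := cH x (e / 2); first by rewrite divr_gt0.
  (* Halving [del] keeps both [s] and its perturbation [s'] within [del] of the centre [x] on the
     first [K] coordinates. *)
  exists ([set s | forall k, (k < K)%N -> `|x k - s k| < del / 2], [set r | r < del / 2]).
    split=> /=; first by apply: nbhs_seq_coord; rewrite divr_gt0.
    by apply: nbhs_right_lt; rewrite divr_gt0.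
  move=> [s r] [/= xs rd] s' ss'.
  have h1 : `|H x - H s| < e / 2.
    by apply: HK => k kK; rewrite (lt_le_trans (xs k kK))// ler_pdivrMr// ler_pMr// ler1n.
  have h2 : `|H x - H s'| < e / 2.
    apply: HK => k kK; rewrite -(subrKA (s k)) (le_lt_trans (ler_normD _ _))//.
    by have := xs k kK; have := ss' k; lra.
  rewrite -(subrKA (H x)) (le_lt_trans (ler_normD _ _))// distrC; lra.
move=> r /= r0 rP; exists (r / 2); first by rewrite divr_gt0.
move=> s s01 s'; apply: (rP (r / 2)) => /=.
- by rewrite sub0r normrN gtr0_norm ?divr_gt0// ltr_pdivrMr// ltr_pMr// ltr1n.
- by rewrite divr_gt0.
- by move=> k; rewrite in_itv/=.
Qed.

Lemma continuous_seq_cube_bounded (R : realType) (H : (nat -> R) -> R) :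
  continuous_seq H ->
  exists2 C : R, 0 <= C & forall s, (forall k, 0 <= s k <= 1) -> `|H s| <= C.
Proof.
move=> cH.
have /compact_near_coveringP/(_ R (pinfty_nbhs R) (fun C s => `|H s| <= C) _) :=
  unit_cube_compact R.
case.
  move=> x _; have [|K [del [del0 HK]]] := cH x 1; first by [].
  exists ([set s | forall k, (k < K)%N -> `|x k - s k| < del], [set r | `|H x| + 1 < r]).
    split=> /=; first exact: nbhs_seq_coord.
    exact: nbhs_pinfty_gt.
  move=> [s r] [/= xs rd]; have := HK s xs.
  have := ler_normB (H x) (H x - H s); rewrite opprB addrC subrK; lra.
move=> M [_ MP]; exists (`|M| + 1) => [|s s01]; first by rewrite addr_ge0.
apply: MP => [|k]; last by rewrite /= in_itv/=.
by rewrite (le_lt_trans (ler_norm M))// ltrDl.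
Qed.

(** * Measurability of network outputs and blocks *)

Lemma borel_fun_row_measurable (d : measure_display) (U : measurableType d) (R : realType)
    (m : nat) (F : 'rV[R]_m -> R) (Y : 'I_m -> U -> R) :
  borel_fun F -> (forall j, measurable_fun setT (Y j)) ->
  measurable_fun setT (fun w => F (\row_j Y j w)).
Proof.
move=> bF mY; apply: (measurableT_comp (borel_fun_measurable _ _ _ bF)).
apply: measurable_rV => j; rewrite (_ : (fun w => _) = Y j)//.
by apply/funext => w; rewrite mxE.
Qed.

Lemma row_measurable (d : measure_display) (U : measurableType d) (R : realType)
    (m : nat) (Y : 'I_m -> U -> R) : (forall j, measurable_fun setT (Y j)) ->
  measurable_fun setT ((fun w => \row_j Y j w) : U -> rV_borel R m).
Proof.
move=> mY; apply: measurable_rV => j; rewrite (_ : (fun w => _) = Y j)//.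
by apply/funext => w; rewrite mxE.
Qed.

Lemma nu_m_process (d : measure_display) (T : measurableType d) (R : realType)
    (m : nat) (Gm : 'rV[R]_m -> R) (x : int -> T -> R) :
  borel_fun Gm -> rv_process x -> rv_process (nu_m Gm x).
Proof. by move=> bG mx t; apply: borel_fun_row_measurable => // j; exact: mx. Qed.

Lemma xhat_m_process (d : measure_display) (T : measurableType d) (R : realType)
    (m : nat) (Gm Hm : 'rV[R]_m -> R) (x : int -> T -> R) :
  borel_fun Gm -> borel_fun Hm -> rv_process x -> rv_process (xhat_m Gm Hm x).
Proof.
move=> bG bH mx t; apply: borel_fun_row_measurable => // j; exact: (nu_m_process _ _ _ _ _ _ bG mx).
Qed.

Lemma block_measurable (d : measure_display) (T : measurableType d) (R : realType)
    (n : nat) (X : int -> T -> R) (t : int) : rv_process X ->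
  measurable_fun setT (block n X t : T -> rV_borel R n).
Proof. by move=> mX; apply: row_measurable => i; exact: mX. Qed.

(** * Lipschitz discriminators and the loss *)

(** [D] may be unbounded. The almost sure bound on [X] makes [D] of [X] bounded by [|D 0| + n C],
    and closeness passes such a bound on to [Y], so both expectations are finite and can be
    subtracted. *)
Lemma expect_lip_close (d : measure_display) (T : measurableType d) (R : realType)
    (P : probability T R) (n : nat) (X Y : T -> 'rV[R]_n) (D : 'rV[R]_n -> R) (C c : R) :
  measurable_fun setT (X : T -> rV_borel R n) ->
  measurable_fun setT (Y : T -> rV_borel R n) ->
  lip1 D -> 0 <= C -> 0 <= c ->
  (\forall w \ae P, forall i, `|X w ord0 i| <= C) ->
  (\forall w \ae P, forall i, `|X w ord0 i - Y w ord0 i| <= c) ->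
  (expect P D X - expect P D Y <= (n%:R * c)%:E)%E.
Proof.
move=> mX mY lD C0 c0 XC XYc.
have mD Z : measurable_fun setT (Z : T -> rV_borel R n) -> measurable_fun setT (D \o Z).
  move=> mZ.
  exact: (measurableT_comp (continuous_rV_measurable _ _ _ (lip1_continuous _ _ _ lD)) mZ).
have DXY : \forall w \ae P, `|D (X w) - D (Y w)| <= n%:R * c.
  apply: filterS XYc => w XYw; apply: (le_trans (lD _ _)).
  by apply: eucl_le => // i; rewrite !mxE.
have DX : \forall w \ae P, `|D (X w)| <= `|D 0| + n%:R * C.
  apply: filterS XC => w XCw; rewrite -[D (X w)](subrK (D 0)) addrC.
  apply: (le_trans (ler_normD _ _)); rewrite lerD2l.
  apply: (le_trans (lD _ _)); rewrite subr0; exact: eucl_le.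
have intX : P.-integrable setT (EFin \o (D \o X)).
  by apply: ae_bounded_integrable DX; exact: mD.
have intY : P.-integrable setT (EFin \o (D \o Y)).
  apply: (@ae_bounded_integrable _ _ _ _ _ (`|D 0| + n%:R * C + n%:R * c)).
    exact: mD.
  apply: filterS2 DX DXY => w h1 h2 /=.
  rewrite -[D (Y w)](subKr (D (X w))).
  by apply: (le_trans (ler_normB _ _)); exact: lerD.
have finY : expect P D Y \is a fin_num by exact: integrable_fin_num intY.
rewrite leeBlDr// addeC.
by apply: (le_expect_bounded _ _ _ _ _ _ _ _ intX intY DXY); rewrite mulr_ge0.
Qed.

(* Testing the loss with one discriminator equal to 0. For unbounded [D] the expectations
   under the trained maps may be infinite, hence the finiteness hypotheses. *)
Lemma expect_lip_bounded_le_loss (d : measure_display) (T : measurableType d) (R : realType)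
    (P : probability T R) (lam : R) (n m : nat) (u : T -> 'rV[R]_n) (x : int -> T -> R)
    (Gm Hm : 'rV[R]_m -> R) (D : 'rV[R]_n -> R) (e : R) :
  0 < lam -> lip1 D ->
  expect P D (block n (nu_m Gm x) 0) \is a fin_num ->
  expect P D (block n (xhat_m Gm Hm x) 0) \is a fin_num ->
  (loss P lam u x Gm Hm <= e%:E)%E ->
  (expect P D u <= expect P D (block n (nu_m Gm x) 0) + e%:E)%E /\
  (expect P D (block n x 0) <=
     expect P D (block n (xhat_m Gm Hm x) 0) + (lam^-1 * e)%:E)%E.
Proof.
move=> lam0 lD finnu finx le_loss.
have l0 : lip1 (fun _ : 'rV[R]_n => 0 : R) by move=> a b; rewrite subrr normr0 sqrtr_ge0.
have E0 Z : expect P (fun _ : 'rV[R]_n => 0 : R) Z = 0%E by rewrite /expect integral0.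
split.
- have : (expect P D u - expect P D (block n (nu_m Gm x) 0) <= e%:E)%E.
    apply: le_trans le_loss; apply: ereal_sup_ubound.
    exists D => //; exists (fun=> 0) => //.
    by rewrite !E0 sube0 mule0 adde0.
  by rewrite leeBlDr// addeC.
- have : (lam%:E * (expect P D (block n x 0) - expect P D (block n (xhat_m Gm Hm x) 0))
      <= e%:E)%E.
    apply: le_trans le_loss; apply: ereal_sup_ubound.
    exists (fun=> 0) => //; exists D => //.
    by rewrite !E0 sube0 add0e.
  by rewrite muleC -lee_pdivlMr// leeBlDr// addeC muleC -EFinM.
Qed.

(** * Stationarity: shifting blocks in time *)

(** Padding by zeros turns a finite window into a sequence, so that a map on sequences that reads
    only [N] coordinates factors through ['rV[R]_N]. *)
Definition rV_ext {R : realType} {N : nat} (v : 'rV[R]_N) (k : nat) : R :=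
  if insub k is Some i then v ord0 i else 0.

Lemma rV_ext_measurable (R : realType) (N k : nat) :
  measurable_fun setT (fun v : rV_borel R N => rV_ext v k).
Proof.
rewrite /rV_ext; case: insubP => [i _ _|_]; last exact: measurable_cst.
exact: measurable_rV_coord.
Qed.

Lemma stationary_past_same_law (d : measure_display) (T : measurableType d) (R : realType)
    (P : probability T R) (x : int -> T -> R) (l N : nat) (F : (nat -> R) -> 'rV[R]_l)
    (t : int) :
  stationary P x ->
  (forall s s' : nat -> R, (forall k, (k < N)%N -> s k = s' k) -> F s = F s') ->
  measurable_fun setT ((F \o @rV_ext R N) : rV_borel R N -> rV_borel R l) ->
  same_law P (fun w => F (fun k => x (t - k%:Z) w)) (fun w => F (fun k => x (0 - k%:Z) w)).
Proof.
move=> [_ stx] locF mF.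
(* The index [0 - i%:Z + t'] has the shape [idx i + h] of [stationary]; both times [t] and [0] are
   then compared with the unshifted window. *)
have FE t' : (fun w => F (fun k => x (t' - k%:Z) w)) =
    (F \o @rV_ext R N) \o fdvec x (fun i : 'I_N => 0 - i%:Z + t').
  apply/funext => w /=; apply: locF => k kN.
  by rewrite /rV_ext insubT mxE/= sub0r addrC.
rewrite !FE; apply: same_law_comp => // A bA.
by rewrite (stx _ _ t A bA) (stx _ _ 0 A bA).
Qed.

Lemma stationary_nu_m_same_law (d : measure_display) (T : measurableType d) (R : realType)
    (P : probability T R) (x : int -> T -> R) (n m : nat) (Gm : 'rV[R]_m -> R) (t : int) :
  stationary P x -> borel_fun Gm ->
  same_law P (block n (nu_m Gm x) 0) (block n (nu_m Gm x) t).
Proof.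
move=> stx bG.
(* Entry [i] reads the lags [i + j] with [i < n] and [j < m], so a window of length [n + m] contains
   them all. *)
pose F (s : nat -> R) : 'rV[R]_n := \row_i Gm (\row_j s (i + j)%N).
have blockE t' : block n (nu_m Gm x) t' = fun w => F (fun k => x (t' - k%:Z) w).
  apply/funext => w; apply/rowP => i; rewrite !mxE; congr (Gm _).
  by apply/rowP => j; rewrite !mxE PoszD opprD addrA.
move=> A bA; rewrite !blockE; apply/esym.
apply: (@stationary_past_same_law _ _ _ _ _ _ (n + m)) bA => //.
- move=> s s' ss'; apply/rowP => i; rewrite !mxE; congr (Gm _).
  by apply/rowP => j; rewrite !mxE ss'// -addnS leq_add// ltnW.
- apply: row_measurable => i; apply: borel_fun_row_measurable => // j.
  exact: rV_ext_measurable.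
Qed.

Lemma stationary_xhat_m_same_law (d : measure_display) (T : measurableType d) (R : realType)
    (P : probability T R) (x : int -> T -> R) (n m : nat) (Gm Hm : 'rV[R]_m -> R) (t : int) :
  stationary P x -> borel_fun Gm -> borel_fun Hm ->
  same_law P (block n (xhat_m Gm Hm x) 0) (block n (xhat_m Gm Hm x) t).
Proof.
move=> stx bG bH.
(* Two nested networks read the lags [i + j + l], hence the window of length [n + m + m]. *)
pose F (s : nat -> R) : 'rV[R]_n :=
  \row_i Hm (\row_(j < m) Gm (\row_(l < m) s (i + j + l)%N)).
have blockE t' : block n (xhat_m Gm Hm x) t' = fun w => F (fun k => x (t' - k%:Z) w).
  apply/funext => w; apply/rowP => i; rewrite !mxE; congr (Hm _).
  apply/rowP => j; rewrite !mxE; congr (Gm _).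
  by apply/rowP => l; rewrite !mxE !PoszD !opprD !addrA.
move=> A bA; rewrite !blockE; apply/esym.
apply: (@stationary_past_same_law _ _ _ _ _ _ (n + m + m)) bA => //.
- move=> s s' ss'; apply/rowP => i; rewrite !mxE; congr (Hm _).
  apply/rowP => j; rewrite !mxE; congr (Gm _).
  by apply/rowP => l; rewrite !mxE ss'// -addnS !leq_add// ltnW.
- apply: row_measurable => i; apply: borel_fun_row_measurable => // j.
  by apply: borel_fun_row_measurable => // l; exact: rV_ext_measurable.
Qed.

Lemma conv_dist_same_law (d : measure_display) (T : measurableType d) (R : realType)
    (P : probability T R) (n : nat) (Xm Ym : nat -> T -> 'rV[R]_n) (X Y : T -> 'rV[R]_n) :
  (forall m, measurable_fun setT (Xm m : T -> rV_borel R n)) ->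
  (forall m, measurable_fun setT (Ym m : T -> rV_borel R n)) ->
  measurable_fun setT (X : T -> rV_borel R n) ->
  measurable_fun setT (Y : T -> rV_borel R n) ->
  (forall m, same_law P (Xm m) (Ym m)) -> same_law P X Y ->
  conv_dist P Xm X -> conv_dist P Ym Y.
Proof.
move=> mXm mYm mX mY XYm XY cX f cf fC.
have mf := continuous_rV_measurable _ _ _ cf.
rewrite -(same_law_expect _ _ _ _ _ _ _ _ mX mY mf XY).
rewrite (_ : (fun m => _) = (fun m => expect P f (Xm m))); first exact: cX.
by apply/funext => m; rewrite -(same_law_expect _ _ _ _ _ _ _ _ (mXm m) (mYm m) mf (XYm m)).
Qed.

(** * Feasible networks and their loss *)

Lemma nu_m_unif_conv (d : measure_display) (T : measurableType d) (R : realType)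
    (x : int -> T -> R) (G : (nat -> R) -> R) (Gm : forall m : nat, 'rV[R]_m -> R) (e : R) :
  unif_conv Gm G -> 0 < e -> \forall m \near \oo,
    forall t w, `|causal G x t w - nu_m (Gm m) x t w| <= e.
Proof.
move=> GmG e0; have [M MP] := GmG _ e0; near=> m => t w.
rewrite distrC; apply: (MP m); near: m; exact: nbhs_infty_ge.
Unshelve. all: by end_near. Qed.

(* [H] is only assumed continuous, but innovations paths lie in the compact cube [0,1]^N,
   around which its modulus of continuity is uniform; hence a sup bound and not mere
   pointwise convergence. *)
Lemma xhat_m_unif_conv (d : measure_display) (T : measurableType d) (R : realType)
    (x : int -> T -> R) (G H : (nat -> R) -> R) (Gm Hm : forall m : nat, 'rV[R]_m -> R)
    (e : R) :
  unif_conv Gm G -> unif_conv Hm H -> continuous_seq H -> 0 < e -> \forall m \near \oo,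
    forall t w, (forall k : nat, 0 <= causal G x (t - k%:Z) w <= 1) ->
      `|causal H (causal G x) t w - xhat_m (Gm m) (Hm m) x t w| <= e.
Proof.
move=> GmG HmH cH e0; have e20 : 0 < e / 2 by rewrite divr_gt0.
have [M MP] := HmH _ e20.
have [del del0 delP] := continuous_seq_cube_unif _ _ _ cH e20.
have del20 : 0 < del / 2 by rewrite divr_gt0.
near=> m => t w nu01.
(* Intermediate point: the ideal decoder [H] fed with the outputs of the finite encoder. Uniform
   continuity around the cube controls the change of input, (A2) the change of decoder. *)
pose s (k : nat) := nu_m (Gm m) x (t - k%:Z) w.
have h1 : `|H (fun k => causal G x (t - k%:Z) w) - H s| < e / 2.
  apply: delP => // k; apply: (@le_lt_trans _ _ (del / 2)); last by lra.
  rewrite /s; move: (t - k%:Z) (w); near: m; exact: nu_m_unif_conv.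
have h2 : `|H s - xhat_m (Gm m) (Hm m) x t w| <= e / 2.
  rewrite distrC; apply: (MP m _ s); near: m; exact: nbhs_infty_ge.
rewrite /causal -/(causal G x) -(subrKA (H s)); apply: (le_trans (ler_normD _ _)).
rewrite [leRHS]splitr; apply: lerD => //; exact: ltW.
Unshelve. all: by end_near. Qed.

Lemma uvec_measurable (d : measure_display) (T : measurableType d) (R : realType)
    (P : probability T R) (n : nat) (U : nat -> T -> R) :
  iid_uniform P U -> measurable_fun setT (uvec n U : T -> rV_borel R n).
Proof. by move=> [[mU _] _]; apply: row_measurable => i; exact: mU. Qed.

Lemma uvec_block_same_law (d : measure_display) (T : measurableType d) (R : realType)
    (P : probability T R) (n : nat) (U : nat -> T -> R) (nu : int -> T -> R) (t : int) :
  iid_uniform P U -> iid_uniform P nu -> same_law P (uvec n U) (block n nu t).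
Proof.
move=> iidU iidnu; apply: (iid_uniform_same_law _ _ _ _ _ _ _ _ _ _ _ iidU iidnu).
- exact: val_inj.
- by move=> i j /addrI/oppr_inj [] /val_inj.
Qed.

(** In law, [u] may be replaced by a block of [nu] and [x] by a block of [H] applied to [nu]. The
    compared blocks then live on the same paths and are almost surely close, and the resulting bound
    is the same for all 1-Lipschitz discriminators, hence holds for the supremum. *)
Lemma feasible_loss_small (d : measure_display) (T : measurableType d) (R : realType)
    (P : probability T R) (lam : R) (n : nat) (U : nat -> T -> R) (x : int -> T -> R)
    (G H : (nat -> R) -> R) (Gm Hm : forall m : nat, 'rV[R]_m -> R) (e : R) :
  rv_process x -> 0 < lam -> iid_uniform P U ->
  (forall m, borel_fun (Gm m)) -> (forall m, borel_fun (Hm m)) ->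
  weak_innovations P x G H -> unif_conv Gm G -> unif_conv Hm H -> 0 < e ->
  \forall m \near \oo, (loss P lam (uvec n U) x (Gm m) (Hm m) <= e%:E)%E.
Proof.
move=> mx lam0 iidU bG bH [iidnu [mxhat [xhatx cH]]] GmG HmH e0.
have mnu : rv_process (causal G x) by case: iidnu => -[].
have [C C0 CP] := continuous_seq_cube_bounded _ _ cH.
have nu01 : \forall w \ae P, forall j : nat, 0 <= causal G x (0 - j%:Z) w <= 1.
  apply/ae_foralln => j; apply: uniform01_ae; first exact: mnu.
  by case: iidnu => _; exact.
(* The block entry at time [- i] decodes the past of [nu] from that time on. *)
have nu01k : \forall w \ae P, forall i k : nat, 0 <= causal G x (0 - i%:Z - k%:Z) w <= 1.
  by apply: filterS nu01 => w h i k; rewrite -addrA -opprD -PoszD.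
(* Chosen so that [(n%:R + 1) * c * (1 + lam) = e], which dominates the error [n%:R * c] of the
   first term plus [lam] times that of the second. *)
pose c := e / ((n%:R + 1) * (1 + lam)).
have n0 : 0 < n%:R + 1 :> R by rewrite ltr_wpDl.
have c0 : 0 < c by rewrite divr_gt0// mulr_gt0// addr_gt0.
have bnd_le : n%:R * c + lam * (n%:R * c) <= e.
  have -> : e = (n%:R + 1) * c + lam * ((n%:R + 1) * c).
    by rewrite /c; field; rewrite !lt0r_neq0// addr_gt0.
  by rewrite lerD// ?ler_wpM2l ?(ltW lam0)// ler_wpM2r ?(ltW c0)// lerDl.
have near_nu := nu_m_unif_conv _ _ _ x _ _ _ GmG c0.
have near_xhat := xhat_m_unif_conv _ _ _ x _ _ _ _ _ GmG HmH cH c0.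
apply: filterS2 near_nu near_xhat => m nu_close xhat_close.
apply: ub_ereal_sup => _ [Dg lDg [Dw lDw <-]].
have mnum := nu_m_process _ _ _ _ _ _ (bG m) mx.
have mxhatm := xhat_m_process _ _ _ _ _ _ _ (bG m) (bH m) mx.
have mDg := continuous_rV_measurable _ _ _ (lip1_continuous _ _ _ lDg).
have mDw := continuous_rV_measurable _ _ _ (lip1_continuous _ _ _ lDw).
rewrite (same_law_expect _ _ _ _ _ _ _ _ (uvec_measurable _ _ _ _ n _ iidU)
  (block_measurable _ _ _ n _ 0 mnu) mDg (uvec_block_same_law _ _ _ _ n _ _ 0 iidU iidnu)).
rewrite -(same_law_expect _ _ _ _ _ _ _ _ (block_measurable _ _ _ n _ 0 mxhat)
  (block_measurable _ _ _ n _ 0 mx) mDw (xhatx _ (fun i : 'I_n => 0 - i%:Z))).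
apply: (@le_trans _ _ ((n%:R * c)%:E + lam%:E * (n%:R * c)%:E)%E); last first.
  by rewrite -EFinM -EFinD lee_fin.
apply: leeD; last (apply: lee_wpmul2l; first by rewrite lee_fin ltW).
- apply: (@expect_lip_close _ _ _ _ _ _ _ _ 1) => //; try exact: block_measurable.
  + exact: ltW.
  + apply: filterS nu01 => w nuw i; rewrite mxE.
    by have /andP[? ?] := nuw i; rewrite ger0_norm.
  + by apply: nearW => w i; rewrite !mxE; exact: nu_close.
- apply: (@expect_lip_close _ _ _ _ _ _ _ _ C) => //; try exact: block_measurable.
  + exact: ltW.
  + by apply: filterS nu01k => w nuw i; rewrite mxE; apply: CP => k; exact: nuw.
  + by apply: filterS nu01k => w nuw i; rewrite !mxE; apply: xhat_close => k; exact: nuw.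
Qed.

(** * Convergence of the trained networks *)

Theorem theorem1 (d : measure_display) (T : measurableType d) (R : realType)
    (P : probability T R) (x : int -> T -> R) (lam : R)
    (U : nat -> T -> R)
    (Theta Eta : nat -> Type)
    (Gnet : forall m : nat, Theta m -> 'rV[R]_m -> R)
    (Hnet : forall m : nat, Eta m -> 'rV[R]_m -> R)
    (G H : (nat -> R) -> R)
    (theta_star : nat -> forall m : nat, Theta m)
    (eta_star : nat -> forall m : nat, Eta m) :
  stationary P x ->
  0 < lam ->
  (* u^(n) := (U_0, ..., U_{n-1}) : i.i.d. U[0,1] variables *)
  iid_uniform P U ->
  (* the parameterized maps are (Borel) measurable *)
  (forall (m : nat) (th : Theta m), borel_fun (Gnet m th)) ->
  (forall (m : nat) (et : Eta m), borel_fun (Hnet m et)) ->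
  (* (A1) existence of a weak innovations representation, H continuous *)
  weak_innovations P x G H ->
  (* (A2) feasibility *)
  (exists (th : forall m : nat, Theta m) (et : forall m : nat, Eta m),
      unif_conv (fun m => Gnet m (th m)) G /\ unif_conv (fun m => Hnet m (et m)) H) ->
  (* (A3) training: (theta_star n m, eta_star n m) globally minimizes L^(n)_m *)
  (forall (n m : nat) (th : Theta m) (et : Eta m),
      (loss P lam (uvec n U) x (Gnet m (theta_star n m)) (Hnet m (eta_star n m))
       <= loss P lam (uvec n U) x (Gnet m th) (Hnet m et))%E) ->
  forall n : nat, (0 < n)%N -> forall t : int,
    conv_dist P (fun m => block n (nu_m (Gnet m (theta_star n m)) x) t)
                (block n (causal G x) t) /\
    conv_dist P (fun m => block n (xhat_m (Gnet m (theta_star n m))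
                                          (Hnet m (eta_star n m)) x) t)
                (block n x t).
Proof.
move=> stx lam0 iidU bG bH wi [th [et [GmG HmH]]] opt n _ t.
have mx : rv_process x by case: stx.
have iidnu : iid_uniform P (causal G x) by case: wi.
have mnu : rv_process (causal G x) by case: iidnu => -[].
have mnum m : rv_process (nu_m (Gnet m (theta_star n m)) x) by exact: nu_m_process.
have mxhatm m : rv_process (xhat_m (Gnet m (theta_star n m)) (Hnet m (eta_star n m)) x).
  exact: xhat_m_process.
have mblock (X : int -> T -> R) t' : rv_process X ->
    measurable_fun setT (block n X t' : T -> rV_borel R n) by exact: block_measurable.
have loss_small (e : R) : 0 < e -> \forall m \near \oo,
    (loss P lam (uvec n U) x (Gnet m (theta_star n m)) (Hnet m (eta_star n m)) <= e%:E)%E.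
  move=> e0.
  have := @feasible_loss_small _ _ _ P lam n U x G H (fun m => Gnet m (th m))
    (fun m => Hnet m (et m)) e mx lam0 iidU (fun m => bG m _) (fun m => bH m _) wi GmG HmH e0.
  by apply: filterS => m; exact: le_trans (opt _ _ _ _).
have finD (D : 'rV[R]_n -> R) (C : R) (X : int -> T -> R) : lip1 D ->
    (forall v, `|D v| <= C) -> rv_process X -> expect P D (block n X 0) \is a fin_num.
  move=> lD DC mX.
  have : P.-integrable setT (EFin \o (D \o block n X 0)).
    apply: (@ae_bounded_integrable _ _ _ _ _ C); last by apply: nearW => w; exact: DC.
    exact: (measurableT_comp (continuous_rV_measurable _ _ _ (lip1_continuous _ _ _ lD))
      (mblock _ 0 mX)).
  by move=> /integrable_fin_num; exact.
split.
(* The loss compares blocks at time 0 with [u]; equality in law brings the claim at time [t] with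
   limit [nu] to that form. *)
- apply: (@conv_dist_same_law _ _ _ _ _ (fun m => block n (nu_m (Gnet m (theta_star n m)) x) 0)
    _ (uvec n U)) => //.
  + by move=> m; exact: mblock.
  + by move=> m; exact: mblock.
  + exact: uvec_measurable iidU.
  + exact: mblock.
  + by move=> m; exact: stationary_nu_m_same_law.
  + exact: uvec_block_same_law.
  apply: conv_dist_lip.
  + by move=> m; exact: mblock.
  + exact: uvec_measurable iidU.
  move=> D C lD DC e e0; apply: filterS (loss_small _ e0) => m le_loss.
  by have [] := expect_lip_bounded_le_loss _ _ _ _ _ _ _ _ _ _ _ _ _ lam0 lD
    (finD _ _ _ lD DC (mnum m)) (finD _ _ _ lD DC (mxhatm m)) le_loss.
- apply: (@conv_dist_same_law _ _ _ _ _ (fun m => block n (xhat_m (Gnet m (theta_star n m))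
    (Hnet m (eta_star n m)) x) 0) _ (block n x 0)).
  + by move=> m; exact: mblock.
  + by move=> m; exact: mblock.
  + exact: mblock.
  + exact: mblock.
  + by move=> m; exact: stationary_xhat_m_same_law.
  + case: stx => _ /(_ n (fun i : 'I_n => 0 - i%:Z) t) stx A bA.
    rewrite -(stx A bA); congr (P (_ @^-1` A)).
    by apply/funext => w; apply/rowP => i; rewrite !mxE sub0r addrC.
  apply: conv_dist_lip.
  + by move=> m; exact: mblock.
  + exact: mblock.
  move=> D C lD DC e e0.
  (* The loss weighs the reconstruction term by [lam], so a loss of at most [lam * e] gives a
     discrepancy of at most [e]. *)
  apply: filterS (loss_small _ (mulr_gt0 lam0 e0)) => m le_loss.
  have [_] := expect_lip_bounded_le_loss _ _ _ _ _ _ _ _ _ _ _ _ _ lam0 lD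
    (finD _ _ _ lD DC (mnum m)) (finD _ _ _ lD DC (mxhatm m)) le_loss.
  by rewrite mulKf// lt0r_neq0.
Qed.
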